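(* Let $m$ be an even positive integer and $l_0=\lfloor 4\sqrt m\rfloor-2$. Then $\tilde l'=l_0$, where $\tilde l'$ is defined for the group $Q_{4m}$ as in the context.
   Context: $Q_{4m}=\langle x,y\mid x^{2m}=1,\ x^m=y^2,\ y^{-1}xy=x^{-1}\rangle$, a group of order $4m$, and $\langle x\rangle y=\{x^ky:0\le k\le 2m-1\}$. A Cayley subset of a finite group $G$ is a subset $S$ that is symmetric, generates $G$ and does not contain the identity; the Cayley graph $X(S)$ has vertex set $G$ with $g\sim h$ iff $g^{-1}h\in S$, and is $|S|$-regular. For a $k$-regular graph $X$, let $\lambda(X)=\max\{|\lambda|: \lambda \text{ an eigenvalue of the adjacency matrix},\ |\lambda|\ne k\}$; $X$ is Ramanujan if $\lambda(X)\le 2\sqrt{k-1}$. Let $\mathcal S'$ be the set of all Cayley subsets $S$ of $Q_{4m}$ with $\langle x\rangle y\not\subseteq S$, $l(S)=4m-|S|$, $\mathcal S'_l=\{S\in\mathcal S': l(S)=l\}$, $\mathcal L'=\{l(S):S\in\mathcal S'\}$, and $\tilde l'=\max\{l\in\mathcal L':\ X(S)\text{ is Ramanujan for all } S\in\mathcal S'_k,\ 1\le k\le l\}$.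
   Formalization: The case m = 2 is excluded, because the claim fails there: for Q_8 every S in S' has l(S) = 3 or 4 and all the graphs are Ramanujan (those with l = 4 are K_{4,4}), so l̃' = 4, while l_0 = 3. *)

(* Defs.v *)
From HB Require Import structures.
From mathcomp Require Import all_boot all_order all_fingroup all_algebra.
From mathcomp Require Import all_solvable.

Set Implicit Arguments.
Unset Strict Implicit.
Unset Printing Implicit Defensive.

Import Order.TTheory GRing.Theory Num.Theory.

(** The group Q_{4m}. The library's ['Q_n] is only meaningful for [n] a power
    of 2, so the group is built here: [Dicyclic a e] stands for [x^a y^e],
    and the product is read off from [y x = x^-1 y] and [y^2 = x^m]. The type
    is the intended one for [0 < m] (['Z_n] is Z/nZ only for [1 < n]); lemma
    [dicyclic_presentation] identifies it with the group of the
    presentation. *)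

Record dicyclic (m : nat) := Dicyclic { dexp : 'Z_(2 * m); dflip : bool }.

Definition dicyclic_pair m (u : dicyclic m) := (dexp u, dflip u).
Definition pair_dicyclic m (p : 'Z_(2 * m) * bool) := Dicyclic p.1 p.2.

Lemma dicyclic_pairK m : cancel (@dicyclic_pair m) (@pair_dicyclic m).
Proof. by case. Qed.

HB.instance Definition _ m :=
  Finite.copy (dicyclic m) (can_type (@dicyclic_pairK m)).

Section DicyclicGroup.
Variable m : nat.
Local Open Scope ring_scope.

Definition dicyclic_one : dicyclic m := Dicyclic 0 false.

Definition dicyclic_mul (u v : dicyclic m) : dicyclic m :=
  Dicyclic (dexp u + (if dflip u then - dexp v else dexp v)
              + (if dflip u && dflip v then m%:R else 0))
           (dflip u (+) dflip v).

Definition dicyclic_inv (u : dicyclic m) : dicyclic m :=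
  if dflip u then Dicyclic (dexp u + m%:R) true else Dicyclic (- dexp u) false.

Lemma dicyclic_mm : m%:R + m%:R = 0 :> 'Z_(2 * m).
Proof.
rewrite -natrD addnn -mul2n.
by case: m => [|n] //; rewrite pchar_Zp // mul2n doubleS.
Qed.

Lemma dicyclic_mulA : associative dicyclic_mul.
Proof.
have Nm : - m%:R = m%:R :> 'Z_(2 * m).
  by apply/eqP; rewrite eq_sym -addr_eq0 dicyclic_mm.
move=> [a []] [b []] [c []]; rewrite /dicyclic_mul /=; congr (Dicyclic _ _);
  rewrite ?addr0 ?opprD ?opprK ?Nm ?addrA //.
all: exact: addrAC.
Qed.

Lemma dicyclic_mul1 : left_id dicyclic_one dicyclic_mul.
Proof. by case=> a e; rewrite /dicyclic_mul /= add0r addr0. Qed.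

Lemma dicyclic_mulV : left_inverse dicyclic_one dicyclic_inv dicyclic_mul.
Proof.
case=> a []; rewrite /dicyclic_mul /dicyclic_inv /dicyclic_one /=;
  last by rewrite addNr addr0.
congr Dicyclic; rewrite -addrA [(- a + m%:R)%R]addrC.
by rewrite addrA -[(a + _ + _)%R]addrA dicyclic_mm addr0 subrr.
Qed.

End DicyclicGroup.

HB.instance Definition _ m := Finite_isGroup.Build (dicyclic m)
  (@dicyclic_mulA m) (@dicyclic_mul1 m) (@dicyclic_mulV m).

Definition dicyclic_x (m : nat) : dicyclic m := Dicyclic 1%R false.
Definition dicyclic_y (m : nat) : dicyclic m := Dicyclic 0%R true.

Section DicyclicPresentation.
Variable m : nat.
Hypothesis m_gt0 : 0 < m.
Local Open Scope group_scope.
Local Notation x := (dicyclic_x m).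
Local Notation y := (dicyclic_y m).

Lemma card_dicyclic : #|{: dicyclic m}| = (4 * m)%N.
Proof.
have bij : bijective (@dicyclic_pair m).
  by exists (@pair_dicyclic m) => [|[]]; first exact: dicyclic_pairK.
rewrite (bij_eq_card bij) card_prod card_bool card_ord Zp_cast.
  by rewrite mulnC mulnA.
by case: m m_gt0 => // n _; rewrite mul2n doubleS.
Qed.

Lemma dicyclic_expx k : x ^+ k = Dicyclic k%:R%R false.
Proof.
elim: k => [|k IH] //.
by rewrite expgS IH /mulg /= /dicyclic_mul /= addr0 -natr1 addrC.
Qed.

Lemma dicyclicE (a : 'Z_(2 * m)) (e : bool) :
  Dicyclic a e = x ^+ a * y ^+ e.
Proof.
rewrite dicyclic_expx natr_Zp; case: e => /=; last by rewrite expg0 mulg1.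
by rewrite expg1 /mulg /= /dicyclic_mul /= !addr0.
Qed.

Lemma dicyclic_relations :
  [/\ x ^+ (2 * m) = 1, x ^+ m = y ^+ 2 & y^-1 * x * y = x^-1].
Proof.
split.
- rewrite dicyclic_expx; congr Dicyclic.
  by rewrite natrM mulr_natl mulr2n dicyclic_mm.
- by rewrite dicyclic_expx expgS expg1 /mulg /= /dicyclic_mul /= oppr0 !add0r.
- rewrite /mulg /invg /= /dicyclic_mul /dicyclic_inv /=.
  by rewrite oppr0 add0r !addr0 [(m%:R - 1)%R]addrC -addrA dicyclic_mm addr0.
Qed.

Lemma dicyclic_gen : <[x]> <*> <[y]> = [set: dicyclic m].
Proof.
apply/eqP; rewrite eqEsubset subsetT; apply/subsetP=> -[a e] _.
by rewrite dicyclicE groupM // mem_gen // inE mem_cycle // orbT.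
Qed.

Lemma dicyclic_presentation :
  [set: dicyclic m] \isog
    Grp (x : y : x ^+ (2 * m), x ^+ m = y ^+ 2, y^-1 * x * y = x^-1).
Proof.
have [x2m xm xy] := dicyclic_relations.
apply: intro_isoGrp => [|rT H].
  by apply/existsP; exists (x, y); rewrite /= !xpair_eqE dicyclic_gen x2m xm xy !eqxx.
case/existsP=> -[u v] /= /eqP[defH u2m um uv].
have uvJ : u ^ v = u^-1 by rewrite conjgE mulgA.
have m2_gt1 : 1 < 2 * m by case: m m_gt0 => // n _; rewrite mul2n doubleS.
have uMod k : u ^+ (k%:R%R : 'Z_(2 * m)) = u ^+ k.
  by rewrite val_Zp_nat // expg_mod.
have uD (a b : 'Z_(2 * m)) : u ^+ (a + b : 'Z_(2 * m))%R = u ^+ a * u ^+ b.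
  by rewrite -[a]natr_Zp -[b]natr_Zp -natrD !uMod expgD.
have uN (a : 'Z_(2 * m)) : u ^+ (- a)%R = (u ^+ a)^-1.
  by apply/eqP; rewrite eq_sym eq_invg_mul -uD subrr.
have uM : u ^+ (m%:R : 'Z_(2 * m))%R = v ^+ 2 by rewrite uMod.
have vu k : v * u ^+ k = (u ^+ k)^-1 * v.
  by rewrite [RHS]conjgC conjVg conjXg uvJ expgVn invgK.
pose f (g : dicyclic m) : rT := u ^+ dexp g * v ^+ dflip g.
have fM : {in [set: dicyclic m] &, {morph f : g h / g * h}}.
  move=> [a e] [b e'] _ _.
  transitivity (u ^+ (a + (if e then - b else b)
                        + (if e && e' then m%:R else 0) : 'Z_(2 * m))%R
                * v ^+ (e (+) e')); first by [].
  transitivity ((u ^+ a * v ^+ e) * (u ^+ b * v ^+ e')); last by [].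
  rewrite !uD; case: e; case: e'; rewrite ?uN ?uM ?expg0 ?expg1 ?mulg1.
  - by rewrite -!mulgA [in RHS](mulgA v) vu !mulgA.
  - by rewrite -!mulgA vu.
  - by rewrite mulgA.
  - by [].
apply/homgP; exists (Morphism fM); apply/eqP; rewrite eqEsubset.
apply/andP; split; last first.
  rewrite -defH join_subG !cycle_subG /=; apply/andP; split; apply/morphimP.
    exists x; rewrite ?inE //= /f /= mulg1.
    by rewrite -[LHS]expg1 -(uMod 1%N).
  by exists y; rewrite ?inE //= /f /= mul1g.
apply/subsetP=> _ /morphimP[[a e] _ _ ->] /=; rewrite /f /= -defH.
by rewrite groupM // groupX // mem_gen // inE cycle_id ?orbT.
Qed.

End DicyclicPresentation.

From mathcomp Require Import classical_sets reals.

Local Open Scope ring_scope.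

Definition cayley_subset (gT : finGroupType) (S : {set gT}) : Prop :=
  [/\ (forall s, s \in S -> s^-1 \in S), <<S>> = [set: gT] & 1 \notin S]%g.

Definition cayley_graph (gT : finGroupType) (S : {set gT}) : rel gT :=
  fun g h => (g^-1 * h)%g \in S.

Definition adjacency_mx (R : realType) (T : finType) (e : rel T) :
    'M[R]_#|T| :=
  \matrix_(i, j) (e (enum_val i) (enum_val j))%:R.

(** [k] is meant to be the degree of the regular graph [e]. A matrix has
    finitely many eigenvalues, so this supremum is a maximum; the set is
    nonempty for a connected graph on at least three vertices (and
    [sup set0 = 0]). Adjacency matrices of Cayley graphs are symmetric, hence
    all their eigenvalues lie in [R]. *)
Definition graph_lambda (R : realType) (T : finType) (e : rel T) (k : nat) : R :=
  sup [set b : R | exists2 a : R,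
         eigenvalue (adjacency_mx R e) a /\ `|a| != k%:R & b = `|a|]%classic.

Definition ramanujan (R : realType) (T : finType) (e : rel T) (k : nat) : Prop :=
  graph_lambda R e k <= 2 * Num.sqrt (k%:R - 1).

Definition cayley_ramanujan (R : realType) (gT : finGroupType)
    (S : {set gT}) : Prop :=
  ramanujan R (cayley_graph S) #|S|.

Section DicyclicCayley.
Variable m : nat.
Local Open Scope nat_scope.
Implicit Type S : {set dicyclic m}.

Definition in_S' S : Prop :=
  cayley_subset S /\ ~~ ((<[dicyclic_x m]> :* dicyclic_y m)%g \subset S).

Definition colength S : nat := 4 * m - #|S|.

Definition in_L' (l : nat) : Prop := exists2 S, in_S' S & colength S = l.

Definition ltilde'_set (R : realType) (l : nat) : Prop :=
  in_L' l /\
  forall (k : nat) S, 1 <= k <= l -> in_S' S -> colength S = k ->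
    cayley_ramanujan R S.

End DicyclicCayley.

Definition is_max (A : nat -> Prop) (l : nat) : Prop :=
  A l /\ forall k, A k -> (k <= l)%N.

(** [is_ltilde' R m l] is "l is the maximum defining ltilde'" for Q_{4m}.
    For [m = 2] this maximum is 4: the elements of S' have 5 or 4 elements,
    and those with 4 elements have Cayley graph K_{4,4}, with eigenvalues
    4, 0 and -4, which is Ramanujan. *)
Definition is_ltilde' (R : realType) (m l : nat) : Prop :=
  is_max (@ltilde'_set m R) l.

(** [Num.truncn] is the floor, as a natural number, of a nonnegative real. *)
Definition l0 (R : realType) (m : nat) : nat :=
  (Num.truncn (4 * Num.sqrt (m%:R : R)) - 2)%N.

(* Main.v *)
(** Let [C] be the complement of [S] and [l = #|C|]. An eigenfunction of the
    Cayley graph of [S] whose eigenvalue differs from the degree has sum zero,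
    so it is an eigenfunction of the convolution by [C], with the opposite
    eigenvalue; hence that eigenvalue is at most [l] in absolute value. The
    bound [l <= 2 sqrt (4m - l - 1)] amounts to [(l + 2)^2 <= 16 m], that is,
    to [l <= l0]. Conversely, for [m] even the subgroup [<x^2, y>] has index 2
    and contains the unique involution [x^m]; it contains symmetric sets [C]
    of every size [3 <= l < 2m] with [1] and [y] in [C], and for those the
    sign character with kernel [<x^2, y>] has eigenvalue exactly [-l]. *)

Require Import Defs.
From mathcomp Require Import classical_sets.
From mathcomp Require Import all_boot all_order all_fingroup all_algebra reals.
From mathcomp Require Import zify lra.

Set Implicit Arguments.
Unset Strict Implicit.
Unset Printing Implicit Defensive.

Import Order.TTheory GRing.Theory Num.Theory.

Lemma bool_morphV (gT : finGroupType) (p : gT -> bool) :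
  {morph p : g h / (g * h)%g >-> g (+) h} -> {morph p : g / (g^-1)%g >-> g}.
Proof.
move=> pM g.
have p1 : p 1%g = false by move: (pM 1%g 1%g); rewrite mulg1; case: (p 1%g).
by move: (pM g^-1%g g); rewrite mulVg p1; case: (p g); case: (p _).
Qed.

Section CayleySpectrum.
Variables (R : realType) (gT : finGroupType).
Implicit Types (S : {set gT}) (f : gT -> R) (a : R).
Local Open Scope ring_scope.

Definition cayley_eigenfun S f a : Prop :=
  forall h, \sum_g f g * ((g^-1 * h)%g \in S)%:R = a * f h.

Lemma cayley_eigenvalueP S a :
  eigenvalue (adjacency_mx R (cayley_graph S)) a <->
  exists2 f, cayley_eigenfun S f a & exists g, f g != 0.
Proof.
split=> [/eigenvalueP[v vA v0]|[f fA [g fg0]]].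
  exists (fun g => v 0 (enum_rank g)) => [h|].
    have := congr1 (fun w : 'rV[R]__ => w 0 (enum_rank h)) vA.
    rewrite !mxE => <-.
    rewrite (reindex _ (onW_bij _ (enum_val_bij gT))) /=.
    by apply: eq_bigr => i _; rewrite enum_valK mxE enum_rankK.
  have /rV0Pn[i vi] := v0.
  by exists (enum_val i); rewrite enum_valK.
apply/eigenvalueP; exists (\row_i f (enum_val i)).
  apply/rowP=> j; rewrite !mxE -fA.
  rewrite [RHS](reindex _ (onW_bij _ (enum_val_bij gT))) /=.
  by apply: eq_bigr => i _; rewrite !mxE.
by apply/rV0Pn; exists (enum_rank g); rewrite mxE enum_rankK.
Qed.

Lemma sum_translate_mem S g : \sum_h ((g^-1 * h)%g \in S)%:R = #|S|%:R :> R.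
Proof.
rewrite (reindex_inj (mulgI g)) -sum1_card natr_sum [RHS]big_mkcond /=.
by apply: eq_bigr => h _; rewrite mulKg; case: (h \in S).
Qed.

Lemma cayley_eigenfun_le S f a :
  cayley_eigenfun S f a -> (exists g, f g != 0) -> `|a| <= #|S|%:R.
Proof.
move=> fA [g fg0].
have pos : 0 < \sum_h `|f h|.
  rewrite (bigD1 g) //= ltr_pwDl ?normr_gt0 //.
  by apply: sumr_ge0.
rewrite -(ler_pM2r pos) mulr_sumr.
apply: (@le_trans _ _ (\sum_h \sum_g `|f g| * ((g^-1 * h)%g \in S)%:R)).
  apply: ler_sum => h _; rewrite -normrM -fA.
  apply: (le_trans (ler_norm_sum _ _ _)).
  by apply: ler_sum => i _; rewrite normrM normr_nat.
rewrite exchange_big /= mulr_sumr; apply: ler_sum => h _.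
by rewrite -mulr_sumr sum_translate_mem mulrC.
Qed.

Lemma cayley_eigenfun_sum0 S f a :
  cayley_eigenfun S f a -> a != #|S|%:R -> \sum_g f g = 0.
Proof.
move=> fA aS; apply/eqP.
have : (a - #|S|%:R) * \sum_g f g == 0.
  rewrite mulrBl subr_eq0 mulr_sumr; apply/eqP.
  transitivity (\sum_h \sum_g f g * ((g^-1 * h)%g \in S)%:R).
    by apply: eq_bigr.
  rewrite exchange_big /= mulr_sumr; apply: eq_bigr => g _.
  by rewrite -mulr_sumr sum_translate_mem mulrC.
by rewrite mulf_eq0 subr_eq0 (negPf aS).
Qed.

Lemma cayley_eigenfun_setC S f a :
  \sum_g f g = 0 -> cayley_eigenfun S f a -> cayley_eigenfun (~: S) f (- a).
Proof.
move=> f0 fA h; rewrite mulNr -fA; apply/eqP; rewrite -addr_eq0 -big_split /=.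
apply/eqP; rewrite -[RHS]f0; apply: eq_bigr => g _.
by rewrite inE; case: (_ \in S); rewrite /= mulr1 mulr0 ?addr0 ?add0r.
Qed.

Lemma cayley_eigenvalue_le_setC S a :
  eigenvalue (adjacency_mx R (cayley_graph S)) a -> `|a| != #|S|%:R ->
  `|a| <= #|~: S|%:R.
Proof.
move=> /cayley_eigenvalueP[f fA f0] aS.
rewrite -normrN; apply: cayley_eigenfun_le f0.
apply: cayley_eigenfun_setC => //; apply: cayley_eigenfun_sum0 fA _.
by apply: contra aS => /eqP->; rewrite normr_nat.
Qed.

Lemma cayley_ramanujan_of_setC S :
  #|~: S|%:R <= 2 * Num.sqrt (#|S|%:R - 1) :> R -> cayley_ramanujan R S.
Proof.
move=> le_S; rewrite /cayley_ramanujan /ramanujan /graph_lambda.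
set E := [set _ | _]%classic.
have [->|E0] := eqVneq E classical_sets.set0; first by rewrite sup0 mulr_ge0 ?sqrtr_ge0.
apply: ge_sup; first exact/set0P.
by move=> _ [a [eig_a aS] ->]; apply: le_trans le_S; apply: cayley_eigenvalue_le_setC.
Qed.

Lemma cayley_ramanujan_eigenvalue S a :
  cayley_ramanujan R S -> eigenvalue (adjacency_mx R (cayley_graph S)) a ->
  `|a| != #|S|%:R -> `|a| <= 2 * Num.sqrt (#|S|%:R - 1).
Proof.
move=> ramS eig_a aS; apply: le_trans ramS.
apply: ub_le_sup; last by exists a.
exists #|S|%:R => _ [b [/cayley_eigenvalueP[f fA f0] _] ->].
exact: cayley_eigenfun_le fA f0.
Qed.

Lemma sign_cayley_eigenfun (p : gT -> bool) S :
  {morph p : g h / (g * h)%g >-> g (+) h} ->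
  cayley_eigenfun S (fun g => (-1) ^+ p g) (\sum_(s in S) (-1) ^+ p s).
Proof.
move=> pM h; have pV := bool_morphV pM.
rewrite (reindex_inj (mulgI h)) /= (reindex_inj invg_inj) /=.
rewrite mulr_suml [RHS]big_mkcond /=; apply: eq_bigr => s _.
rewrite invMg invgK mulgKV pM pV signr_addb.
by case: (s \in S); rewrite ?mulr0 // mulr1 mulrC.
Qed.

Lemma sum_sign_char (p : gT -> bool) t :
  {morph p : g h / (g * h)%g >-> g (+) h} -> p t ->
  \sum_g (-1) ^+ p g = 0 :> R.
Proof.
move=> pM pt; have : \sum_g (-1) ^+ p g = - \sum_g (-1) ^+ p g :> R.
  rewrite {1}(reindex_inj (mulgI t)) /= -sumrN; apply: eq_bigr => g _.
  by rewrite pM signr_addb pt expr1 mulN1r.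
by move=> ?; lra.
Qed.

Lemma setC_ker_sign_eigenvalue (p : gT -> bool) t (C : {set gT}) :
  {morph p : g h / (g * h)%g >-> g (+) h} -> p t ->
  (forall g, g \in C -> ~~ p g) ->
  eigenvalue (adjacency_mx R (cayley_graph (~: C))) (- #|C|%:R).
Proof.
move=> pM pt pC; apply/cayley_eigenvalueP; exists (fun g => (-1) ^+ p g); last first.
  by exists 1%g; rewrite signr_eq0.
apply: cayley_eigenfun_setC; first exact: sum_sign_char pt.
have -> : #|C|%:R = \sum_(s in C) (-1) ^+ p s :> R.
  rewrite -sum1_card natr_sum; apply: eq_bigr => s /pC.
  by case: (p s).
exact: sign_cayley_eigenfun.
Qed.

End CayleySpectrum.

Section GroupSets.
Variable gT : finGroupType.
Implicit Types (A B T : {set gT}).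

Definition sym_set A := forall g, g \in A -> (g^-1)%g \in A.

Lemma sym_setC A : sym_set A -> sym_set (~: A).
Proof.
by move=> symA g; rewrite !inE; apply: contra => /symA; rewrite invgK.
Qed.

Lemma sym_set_interpolate B T j :
  B \subset T -> sym_set B -> sym_set T ->
  (forall g, g \in T :\: B -> (g^-1)%g != g) ->
  #|B| + 2 * j <= #|T| ->
  exists A, [/\ B \subset A, A \subset T, sym_set A & #|A| = #|B| + 2 * j].
Proof.
move=> sBT symB symT noinv.
elim: j => [_|j IHj ltT].
  by exists B; rewrite muln0 addn0.
have [|A [sBA sAT symA cardA]] := IHj; first by lia.
have : ~~ (T \subset A) by apply/negP=> /subset_leq_card; lia.
case/subsetPn=> g gT' gA.
have gVA : (g^-1)%g \notin A by apply: contra gA => /symA; rewrite invgK.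
have gB : g \notin B by apply: contra gA; apply: (subsetP sBA).
exists (g |: ((g^-1)%g |: A)); split.
- by apply: subset_trans sBA _; apply/subsetP=> h hA; rewrite !inE hA !orbT.
- by rewrite !subUset !sub1set gT' sAT symT.
- move=> h; rewrite !inE.
  by case/or3P=> [/eqP->|/eqP->|/symA->]; rewrite ?invgK ?eqxx ?orbT.
- have neq : g != (g^-1)%g by rewrite eq_sym noinv // inE gB.
  by rewrite !cardsU1 !inE (negPf neq) (negPf gA) (negPf gVA) cardA /=; lia.
Qed.

Lemma setC_ker_gen (p : gT -> bool) t (C : {set gT}) :
  {morph p : g h / (g * h)%g >-> g (+) h} -> p t ->
  (forall g, g \in C -> ~~ p g) -> <<~: C>>%g = [set: gT].
Proof.
move=> pM pt pC; apply/eqP; rewrite eqEsubset subsetT; apply/subsetP=> g _.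
have podd h : p h -> h \in <<~: C>>%g.
  by move=> ph; rewrite mem_gen // inE; apply: contraL ph; apply: pC.
have [/podd//|pg] := boolP (p g).
by rewrite -(mulgK t g) groupM ?groupV ?podd // pM pt (negPf pg).
Qed.

End GroupSets.

Section DicyclicParity.
Variable m : nat.
Hypotheses (m_gt0 : 0 < m) (m_even : ~~ odd m).
Local Notation x := (dicyclic_x m).
Local Notation y := (dicyclic_y m).
Local Notation z := (Dicyclic m%:R%R false : dicyclic m).

Let m2_gt1 : 1 < 2 * m. Proof. by lia. Qed.

Definition dicyclic_parity (g : dicyclic m) : bool := odd (dexp g).

Lemma Zp_oddD (a b : 'Z_(2 * m)) : odd (a + b)%R = odd a (+) odd b.
Proof. by rewrite /= odd_mod ?oddD // Zp_cast // oddM. Qed.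

Lemma Zp_oddN (a : 'Z_(2 * m)) : odd (- a)%R = odd a.
Proof.
have := Zp_oddD a (- a)%R; rewrite subrr /=.
by case: (odd a); case: (odd _).
Qed.

Lemma Zp_odd_half : odd (m%:R%R : 'Z_(2 * m)) = false.
Proof. by rewrite val_Zp_nat // odd_mod ?(negPf m_even) // oddM. Qed.

Lemma dicyclic_parityM :
  {morph dicyclic_parity : g h / (g * h)%g >-> g (+) h}.
Proof.
move=> [a e] [b e'].
rewrite [LHS](_ : _ = odd (a + (if e then - b else b)
                             + (if e && e' then m%:R else 0) : 'Z_(2 * m))%R) //.
by case: e; case: e'; rewrite !Zp_oddD ?Zp_oddN ?Zp_odd_half ?addbF.
Qed.

Lemma dicyclic_parity_x : dicyclic_parity x.
Proof. by []. Qed.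

Lemma half_neq0 : (m%:R != 0 :> 'Z_(2 * m))%R.
Proof.
apply/eqP=> /(congr1 val); rewrite /= val_Zp_nat // modn_small; lia.
Qed.

Lemma half_eqN : (- m%:R = m%:R :> 'Z_(2 * m))%R.
Proof. by apply/eqP; rewrite eq_sym -addr_eq0 dicyclic_mm. Qed.

Lemma Zp_double_eq0 (a : 'Z_(2 * m)) :
  (a + a = 0)%R -> a = 0%R \/ a = (m%:R)%R.
Proof.
move=> /(congr1 val) /=; rewrite [X in _ %% X]Zp_cast // => /eqP.
have lta : a < 2 * m by have := ltn_ord a; rewrite [X in _ < X]Zp_cast.
rewrite -/(dvdn _ _) addnn -mul2n dvdn_pmul2l // => /dvdnP[q aq].
have : q < 2 by move: lta; rewrite aq ltn_pmul2r.
case: q aq => [|[|//]] aq _; [left|right]; apply/val_inj => /=.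
  by rewrite aq.
by rewrite val_Zp_nat // modn_small ?aq ?mul1n //; lia.
Qed.

Lemma dicyclic_involution (g : dicyclic m) : (g^-1 = g)%g -> g = 1%g \/ g = z.
Proof.
case: g => a []; rewrite /invg /= /dicyclic_inv /= => -[] /eqP.
  by rewrite -subr_eq0 addrAC subrr add0r (negPf half_neq0).
rewrite eq_sym -addr_eq0 => /eqP/Zp_double_eq0[] ->; [by left | by right].
Qed.

Lemma card_dicyclic_even : #|[set g | ~~ dicyclic_parity g]| = 2 * m.
Proof.
set H := [set g | _].
have cH : #|~: H| = #|H|.
  rewrite -(card_imset (mem H) (mulgI x)); apply: eq_card => g.
  rewrite !inE negbK; apply/idP/imsetP=> [pg|[h]].
    exists (x^-1 * g)%g; last by rewrite mulKVg.
    by rewrite inE; move: pg; rewrite -{1}(mulKVg x g) dicyclic_parityM dicyclic_parity_x.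
  by rewrite inE => ph ->; rewrite dicyclic_parityM dicyclic_parity_x.
have := cardsC H; rewrite cH card_dicyclic //; lia.
Qed.

Lemma dicyclic_yV : (y^-1)%g = Dicyclic (m%:R)%R true.
Proof. by rewrite /invg /= /dicyclic_inv /= add0r. Qed.

Lemma dicyclic_zV : (z^-1)%g = z.
Proof. by rewrite /invg /= /dicyclic_inv /= half_eqN. Qed.

Lemma dicyclic_sym_set_exists l : 3 <= l -> l < 2 * m ->
  exists C : {set dicyclic m},
    [/\ sym_set C, 1%g \in C, y \in C,
        (forall g, g \in C -> ~~ dicyclic_parity g) & #|C| = l].
Proof.
move=> l3 lm; set H := [set g | ~~ dicyclic_parity g].
have pz : ~~ dicyclic_parity z by rewrite /dicyclic_parity Zp_odd_half.
have pV := bool_morphV dicyclic_parityM.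
have symH : sym_set H by move=> g; rewrite !inE pV.
pose B := [set 1%g; y; y^-1%g].
have symB : sym_set B.
  by move=> g; rewrite !inE => /orP[/orP[]|] /eqP->; rewrite ?invg1 ?invgK eqxx ?orbT.
have sBH : B \subset H.
  by apply/subsetP=> g; rewrite !inE => /orP[/orP[]|] /eqP->; rewrite ?pV.
have neq_y : y != (y^-1)%g.
  by rewrite dicyclic_yV; apply/eqP=> -[] /eqP; rewrite eq_sym (negPf half_neq0).
have neq_flip (g h : dicyclic m) : dflip g != dflip h -> (g == h) = false.
  by move=> gh; apply: contraNF gh => /eqP->.
have cB : #|B| = 3.
  by rewrite /B -setUA cardsU1 cards2 !inE neq_y dicyclic_yV !neq_flip.
have zB : z \notin B.
  rewrite !inE dicyclic_yV !(@neq_flip z (Dicyclic _ true)) // !orbF.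
  by apply/eqP=> -[] /eqP; rewrite (negPf half_neq0).
have zH : z \in H by rewrite inE.
have [l_odd|l_even] := boolP (odd l).
  have [|||||A [sBA sAT symA cA]] := @sym_set_interpolate _ B (H :\ z) (l./2.-1).
  - by rewrite subsetD1 sBH zB.
  - exact: symB.
  - move=> g; rewrite !inE pV => /andP[gz ->]; rewrite andbT.
    by apply: contra gz => /eqP/(congr1 invg); rewrite invgK dicyclic_zV => ->.
  - move=> g; rewrite !inE => /andP[gB /andP[gz _]].
    apply: contra gB => /eqP/dicyclic_involution[gE|gE]; first by rewrite gE eqxx.
    by rewrite gE eqxx in gz.
  - have := cardsD1 z H; rewrite zH card_dicyclic_even cB add1n; move: #|_| => n cn; lia.
  exists A; split=> //; try by apply: (subsetP sBA); rewrite !inE eqxx ?orbT.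
    by move=> g /(subsetP sAT); rewrite !inE => /andP[].
  by rewrite cA cB; lia.
have [|||||A [sBA sAT symA cA]] := @sym_set_interpolate _ (z |: B) H (l./2.-2).
- by rewrite subUset sub1set zH.
- by move=> g; rewrite !(in_setU1 _ z) => /predU1P[->|/symB->]; rewrite ?dicyclic_zV ?eqxx ?orbT.
- exact: symH.
- move=> g; rewrite !inE negb_or => /andP[/andP[gz gB] _].
  apply: contra gB => /eqP/dicyclic_involution[gE|gE]; first by rewrite gE eqxx.
  by rewrite gE eqxx in gz.
- by rewrite cardsU1 zB card_dicyclic_even cB; lia.
exists A; split=> //; try by apply: (subsetP sBA); rewrite !inE eqxx ?orbT.
  by move=> g /(subsetP sAT); rewrite !inE.
by rewrite cA cardsU1 zB cB; lia.
Qed.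

End DicyclicParity.

Section Bounds.
Variables (R : realType) (m : nat).
Hypothesis m_gt0 : 0 < m.
Local Open Scope ring_scope.

Lemma leq_l0 l : (l <= l0 R m)%N = ((l + 2) ^ 2 <= 16 * m)%N.
Proof.
have ge0 : 0 <= 4 * Num.sqrt (m%:R : R) by rewrite mulr_ge0 ?sqrtr_ge0.
have ge2 n : (n <= Num.truncn (4 * Num.sqrt (m%:R : R)))%N = (n ^ 2 <= 16 * m)%N.
  rewrite truncn_ge_nat // -ler_sqr ?nnegrE // exprMn sqr_sqrtr //.
  by rewrite -!natrX -natrM ler_nat.
by rewrite /l0 leq_subRL ?ge2 1?addnC //; lia.
Qed.

Lemma le_ramanujan_bound l : (l < 4 * m)%N ->
  (l%:R <= 2 * Num.sqrt ((4 * m - l)%:R - 1) :> R) = ((l + 2) ^ 2 <= 16 * m)%N.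
Proof.
move=> lm; have -> : (4 * m - l)%:R - 1 = (4 * m - l - 1)%:R :> R.
  by rewrite [RHS]natrB //; lia.
rewrite -ler_sqr ?nnegrE ?mulr_ge0 ?sqrtr_ge0 // exprMn sqr_sqrtr //.
by rewrite -!natrX -natrM ler_nat; lia.
Qed.

End Bounds.

Lemma card_setC_dicyclic m (S : {set dicyclic m}) :
  0 < m -> #|~: S| = colength S.
Proof. by move=> m_gt0; rewrite /colength -(card_dicyclic m_gt0) -(cardsC S) addKn. Qed.

Lemma colength_setC m (C : {set dicyclic m}) : 0 < m -> colength (~: C) = #|C|.
Proof. by move=> m_gt0; rewrite -card_setC_dicyclic // setCK. Qed.

Lemma in_S'_setC m (C : {set dicyclic m}) : 0 < m -> ~~ odd m ->
  sym_set C -> 1%g \in C -> dicyclic_y m \in C ->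
  (forall g, g \in C -> ~~ dicyclic_parity g) -> in_S' (~: C).
Proof.
move=> m_gt0 m_even symC C1 Cy pC; split.
  split; [exact: sym_setC| |by rewrite inE C1].
  exact: setC_ker_gen (dicyclic_parityM _ _) (dicyclic_parity_x m) pC.
apply/subsetPn; exists (dicyclic_y m); last by rewrite inE Cy.
by rewrite rcoset_refl.
Qed.

(* The case m = 2 is excluded because the equality fails there:
   l0 = 3, whereas the maximum is 4 (see Defs.v). *)
Theorem theorem4p4 (R : realType) (m : nat) (m_gt0 : 0 < m)
    (m_even : ~~ odd m) (m_neq2 : m <> 2) :
  is_ltilde' R m (l0 R m).
Proof.
have m_ge4 : 4 <= m.
  by case: m m_gt0 m_even m_neq2 => [|[|[|[|n]]]].
have l0_ge6 : 6 <= l0 R m by rewrite leq_l0 //; lia.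
have l0_lt : (l0 R m).+1 < 2 * m.
  rewrite ltnNge; apply/negP => lt.
  by have : 2 * m - 1 <= l0 R m; [lia | rewrite leq_l0 //; nia].
split=> [|k [_ ramk]].
  split.
    have [||C [symC C1 Cy pC cC]] :=
      dicyclic_sym_set_exists m_gt0 m_even (l := l0 R m); try lia.
    by exists (~: C); [apply: in_S'_setC|rewrite colength_setC].
  move=> k S /andP[_ k_le] _ Sk; apply: cayley_ramanujan_of_setC.
  have cS : #|S| = 4 * m - k.
    by move: (max_card S); rewrite -Sk /colength card_dicyclic //; lia.
  by rewrite card_setC_dicyclic // Sk cS le_ramanujan_bound -?(leq_l0 R) //; lia.
rewrite leqNgt; apply/negP=> lt_k.
have [||C [symC C1 Cy pC cC]] :=
  dicyclic_sym_set_exists m_gt0 m_even (l := (l0 R m).+1); try lia.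
have cS : #|~: C| = 4 * m - (l0 R m).+1.
  by rewrite -cC -(card_dicyclic m_gt0) -(cardsC C) addKn.
have ramC : cayley_ramanujan R (~: C).
  by apply: (ramk (l0 R m).+1); rewrite ?lt_k ?colength_setC //; apply: in_S'_setC.
have eigC := setC_ker_sign_eigenvalue R (dicyclic_parityM m_gt0 m_even)
  (dicyclic_parity_x m) pC.
have := cayley_ramanujan_eigenvalue ramC eigC.
rewrite normrN normr_nat cS cC eqr_nat le_ramanujan_bound -?(leq_l0 R) ?ltnn //; last by lia.
by move=> /(_ _)/notF; apply; apply/eqP; lia.
Qed.
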